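(* For every integer $n\ge 1$, the central trinomial coefficients $c_n$ and the Motzkin numbers $m_n$ satisfy $$c_{n+1} = c_n + 2n\, m_{n-1}.$$
   Context: For integers $n\ge 0$, the central trinomial coefficients are $$c_n=\sum_{k=0}^{\lfloor n/2\rfloor}\frac{n!}{(k!)^2\,(n-2k)!}$$ (equivalently, $c_n$ is the coefficient of $x^n$ in $(1+x+x^2)^n$), and the Motzkin numbers are $$m_n=\sum_{k=0}^{\lfloor n/2\rfloor}\frac{n!}{k!\,(k+1)!\,(n-2k)!}.$$ *)

(* Defs.v *)
From mathcomp Require Import all_boot.

Set Implicit Arguments.
Unset Strict Implicit.
Unset Printing Implicit Defensive.

(* In both sums the natural-number quotients are exact: see
   [central_trinomial_dvd] and [motzkin_dvd] below. *)
Definition central_trinomial (n : nat) : nat :=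
  \sum_(0 <= k < (n %/ 2).+1) n`! %/ (k`! ^ 2 * (n - 2 * k)`!).

Definition motzkin (n : nat) : nat :=
  \sum_(0 <= k < (n %/ 2).+1) n`! %/ (k`! * k.+1`! * (n - 2 * k)`!).

Lemma central_trinomial_dvd (n k : nat) :
  k <= n %/ 2 -> k`! ^ 2 * (n - 2 * k)`! %| n`!.
Proof.
rewrite leq_divRL // mulnC => le_2k_n.
rewrite -(bin_fact le_2k_n) dvdn_mull // dvdn_mul //.
have le_k_2k : k <= 2 * k by rewrite leq_pmull.
by rewrite -(bin_fact le_k_2k) mul2n -addnn addnK dvdn_mull.
Qed.

Lemma motzkin_dvd (n k : nat) :
  k <= n %/ 2 -> k`! * k.+1`! * (n - 2 * k)`! %| n`!.
Proof.
rewrite leq_divRL // mulnC => le_2k_n.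
rewrite -(bin_fact le_2k_n) dvdn_mull // dvdn_mul //.
have le_k_2k : k <= 2 * k by rewrite leq_pmull.
have subk : 2 * k - k = k by rewrite mul2n -addnn addnK.
rewrite -(bin_fact le_k_2k) subk factS mulnCA dvdn_pmul2r ?muln_gt0 ?fact_gt0 //.
rewrite -(@Gauss_dvdr _ k) ?coprimeSn //.
have := mul_bin_left (2 * k) k; rewrite subk => <-.
exact: dvdn_mulr.
Qed.

(* Main.v *)
Require Import Defs.
From mathcomp Require Import all_boot.

(** Over binomial coefficients, the [k]-th term of [c_n] is
    ['C(n, 2 * k) * 'C(2 * k, k)], so Pascal's rule in the upper index gives
      [c_(n+1) - c_n = \sum_k 'C(n, 2 * k + 1) * 'C(2 * k + 2, k + 1)].
    On the other side, multiplying the [k]-th term of [m_(n-1)] by [n] cancels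
    the Catalan denominator: it becomes ['C(n, 2 * k + 1) * 'C(2 * k + 1, k)]
    (lemma [mul_motzkin_bin]).  The two sums agree up to a factor 2 because
    ['C(2 * k + 2, k + 1)] is twice ['C(2 * k + 1, k)] (lemma [bin_central]).

    Both binomial expansions are stated over any sufficiently long range of
    summation, the extra terms vanishing; this lets the sums of the identity
    share one range although their natural ranges depend on the parity
    of [n]. *)

Lemma sum_nat_widen0 (F : nat -> nat) (m N : nat) :
  m <= N -> (forall k, m <= k -> F k = 0) ->
  \sum_(0 <= k < N) F k = \sum_(0 <= k < m) F k.
Proof.
move=> le_mN F0; rewrite (big_cat_nat (n := m)) //=.
rewrite [X in _ + X]big_nat_cond [X in _ + X]big1 ?addn0 // => k.
by case/andP=> /andP[/F0].
Qed.

Lemma central_trinomial_bin (n N : nat) :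
  n < 2 * N ->
  central_trinomial n = \sum_(0 <= k < N) 'C(n, 2 * k) * 'C(2 * k, k).
Proof.
move=> lt_n_2N; rewrite (sum_nat_widen0 _ (n %/ 2).+1); first last.
- by move=> k; rewrite ltn_divLR // mulnC => lt_n_2k; rewrite bin_small.
- by rewrite ltn_divLR // mulnC.
apply: eq_big_nat => k /andP[_]; rewrite ltnS => le_k_half.
have le_2k_n : 2 * k <= n by rewrite mulnC -leq_divRL.
apply/eqP; rewrite eq_sym eqn_div ?central_trinomial_dvd //; last first.
  by rewrite muln_gt0 expn_gt0 !fact_gt0.
have le_k_2k : k <= 2 * k by rewrite leq_pmull.
have := bin_fact le_k_2k; rewrite {2}mul2n -addnn addnK => fact_2k.
by rewrite -(bin_fact le_2k_n) -fact_2k expnS expn1 !mulnA.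
Qed.

Lemma odd_row_sub (k : nat) : (2 * k).+1 - k = k.+1.
Proof. by rewrite mul2n -addnn -addnS addKn. Qed.

(** The factor [n.+1] completes [n`!] to [n.+1`!], the numerator of
    ['C(n.+1, 2 * k + 1)], and the product [k`! * k.+1`!] is already the
    denominator of ['C(2 * k + 1, k)]; no Catalan quotient is left. *)
Lemma mul_motzkin_bin (n N : nat) :
  n < 2 * N ->
  n.+1 * motzkin n =
  \sum_(0 <= k < N) 'C(n.+1, (2 * k).+1) * 'C((2 * k).+1, k).
Proof.
move=> lt_n_2N; rewrite (sum_nat_widen0 _ (n %/ 2).+1); first last.
- by move=> k; rewrite ltn_divLR // mulnC => lt_n_2k; rewrite bin_small.
- by rewrite ltn_divLR // mulnC.
rewrite big_distrr /=; apply: eq_big_nat => k /andP[_]; rewrite ltnS => le_k_half.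
have le_2k_n : (2 * k).+1 <= n.+1 by rewrite ltnS mulnC -leq_divRL.
rewrite muln_divA ?motzkin_dvd // -factS.
apply/eqP; rewrite eq_sym eqn_div ?muln_gt0 ?fact_gt0 //; last first.
  by rewrite factS dvdn_mull ?motzkin_dvd.
have le_k_2k : k <= (2 * k).+1 by rewrite leqW ?leq_pmull.
have := bin_fact le_k_2k; rewrite odd_row_sub => fact_2k1.
by rewrite -(bin_fact le_2k_n) -fact_2k1 subSS !mulnA.
Qed.

(** A middle entry of an even row of Pascal's triangle is the sum of the two
    middle entries of the row above, which are equal by symmetry. *)
Lemma bin_central (k : nat) : 'C(2 * k.+1, k.+1) = 2 * 'C((2 * k).+1, k).
Proof.
have le_k_2k : k <= (2 * k).+1 by rewrite leqW ?leq_pmull.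
have := bin_sub le_k_2k; rewrite odd_row_sub => sym_k.
by rewrite (mulnS 2) !addSn add0n binS sym_k addnn -mul2n.
Qed.

Theorem theorem16 (n : nat) (hn : 1 <= n) :
  central_trinomial n.+1 = central_trinomial n + 2 * n * motzkin n.-1.
Proof.
case: n hn => // n _ /=.
have lt_n : n < 2 * n.+1 by rewrite leq_pmull.
rewrite -mulnA (mul_motzkin_bin _ n.+1 lt_n).
rewrite (central_trinomial_bin n.+2 n.+2); last by rewrite (mulnS 2) !ltnS.
rewrite (central_trinomial_bin n.+1 n.+2); last by rewrite (mulnS 2) !ltnS ltnW.
(* The term of index 0 in both central trinomial sums is 1; splitting it off
   aligns the remaining [n.+1] terms with those of the Motzkin sum. *)
rewrite !(big_nat_recl n.+1) //= !muln0 !bin0 -addnA; congr (_ + _).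
rewrite big_distrr -big_split /=; apply: eq_bigr => k _.
by rewrite mulnCA -bin_central -mulnDl (mulnS 2) !addSn add0n binS.
Qed.
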